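(* Consider diagrams of $Y$-oriented trivalent spatial graphs. For $\tau\in\{\text{splitting},\text{merging}\}$ let $\mathcal{A}_\tau$ be the set of the six $Y$-oriented R4 moves whose vertex has type $\tau$, and for $\tau\in\{\text{splitting},\text{merging}\}$ and $\sigma\in\{\text{over},\text{under}\}$ let $\mathcal{B}_{\tau,\sigma}$ be the set of the six $Y$-oriented R5 moves whose vertex has type $\tau$ and in which the moving strand passes $\sigma$ the edges incident to the vertex. Then, for any choice of one move from each of the six sets $\mathcal{A}_{\text{splitting}}$, $\mathcal{A}_{\text{merging}}$, $\mathcal{B}_{\text{splitting},\text{over}}$, $\mathcal{B}_{\text{merging},\text{over}}$, $\mathcal{B}_{\text{splitting},\text{under}}$, $\mathcal{B}_{\text{merging},\text{under}}$, the six chosen moves together with any minimal generating set of the oriented classical Reidemeister moves form a generating set of Reidemeister moves for $Y$-oriented trivalent spatial graphs.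
   Context: A trivalent spatial graph is a finite graph with all vertices of degree 3 (circle components without vertices are allowed) embedded in $\mathbb{R}^3$, considered up to ambient isotopy. A $Y$-orientation is an orientation of all edges such that no vertex is a source or a sink; so each vertex is either splitting (one incoming edge, two outgoing edges) or merging (two incoming edges, one outgoing edge). At such a vertex, call the unique incoming edge of a splitting vertex, or the unique outgoing edge of a merging vertex, the special edge. Diagrams are generic planar projections with over/under crossing information, considered up to planar isotopy. Moves may be applied in either direction. Unoriented moves. The classical Reidemeister moves are the usual moves R1, R2, R3. R4: let $v$ be a vertex with no crossings nearby, with incident edges $e_0,e_1,e_2$; the move exchanges the cyclic order of the edges $e_1,e_2$ at $v$, at the cost of introducing one crossing between $e_1$ and $e_2$ next to $v$ (a half twist of $e_1,e_2$), leaving the diagram outside a small disk around $v$ fixed. Up to planar isotopy, a $Y$-oriented R4 move is determined by the type (splitting or merging) of the vertex, the position of the special edge among the untwisted edge, the left twisted edge and the right twisted edge in the uncrossed diagram, and which of the two twisted edges is over at the crossing; this gives 12 moves. R5: let $v$ be a vertex with incident edges $e_0,e_1,e_2$ and let $s$ be a strand (not ending at $v$) which crosses $e_0$ near $v$ once, and crosses neither $e_1$ nor $e_2$ nearby; the move pushes $s$ across $v$ so that afterwards $s$ crosses each of $e_1$ and $e_2$ once and does not cross $e_0$. The strand $s$ is either over at all these crossings or under at all these crossings. Up to planar isotopy, a $Y$-oriented R5 move is determined by the vertex type, the position of the special edge (it is $e_0$, or the left or the right one of the other two edges), the direction of $s$, and whether $s$ is over or under; this gives 24 moves. The full set of $Y$-oriented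 Reidemeister moves consists of all oriented versions of R1, R2, R3 together with the 12 $Y$-oriented R4 moves and the 24 $Y$-oriented R5 moves. A set $S$ of oriented moves generates another set of oriented moves if every move of the latter can be realized as a finite sequence of planar isotopies and moves of $S$ or their inverses, performed locally, i.e. inside the disk where the move takes place. A generating set of Reidemeister moves for $Y$-oriented trivalent spatial graphs is a set generating the full set of $Y$-oriented Reidemeister moves. A minimal generating set of oriented classical Reidemeister moves is a set of oriented R1, R2, R3 moves that generates all oriented R1, R2, R3 moves, and no proper subset of which does. *)

(* Defs.v *)
(* Diagrams in a disk, up to planar isotopy.  The disk is drawn as a rectangle
   and a diagram is put in general position with respect to the height
   function, so that it is a finite stack of horizontal slices, read from
   bottom to top, each containing one elementary piece (local extremum,
   crossing or trivalent vertex) and otherwise vertical strands.  Two such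
   stacks are diagrams that are planar isotopic relative to the boundary iff
   they are related by the relation [isotopy] below applied inside a
   rectangle (this is the usual presentation of planar tangle diagrams with
   coupons, i.e. of a free strict pivotal category). *)
From Stdlib Require Import Relations.
From mathcomp Require Import all_boot classical_sets.
Set Implicit Arguments.
Unset Strict Implicit.
Unset Printing Implicit Defensive.

Local Open Scope classical_set_scope.

(* Direction of an oriented strand where it meets a horizontal line. *)
Inductive dir := Up | Dn.

Definition opp (d : dir) : dir := if d is Up then Dn else Up.

Notation word := (seq dir).

Inductive level := Over | Under.

Definition flip (o : level) : level := if o is Over then Under else Over.

(* [Cross x y o]: the strand from bottom left to top right has direction [x]
   and is [o] the strand from bottom right to top left, of direction [y].
   [Fork b l r] and [Join l r t] are vertices whose legs are
   (bottom, top left, top right) and (bottom left, bottom right, top). *)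
Inductive piece :=
| Cup of dir
| Cap of dir
| Cross of dir & dir & level
| Fork of dir & dir & dir
| Join of dir & dir & dir.

Definition pdom (g : piece) : word :=
  match g with
  | Cup _ => [::]
  | Cap x => [:: x; opp x]
  | Cross x y _ => [:: x; y]
  | Fork b _ _ => [:: b]
  | Join l r _ => [:: l; r]
  end.

Definition pcod (g : piece) : word :=
  match g with
  | Cup x => [:: x; opp x]
  | Cap _ => [::]
  | Cross x y _ => [:: y; x]
  | Fork _ l r => [:: l; r]
  | Join _ _ t => [:: t]
  end.

(* Y-orientation: no vertex is a source or a sink. *)
Definition y_oriented (g : piece) : bool :=
  match g with
  | Fork Dn Up Up | Join Dn Dn Up => false
  | Fork Up Dn Dn | Join Up Up Dn => false
  | _ => true
  end.

(* A piece with the vertical strands to its left and to its right. *)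
Record slice := Slice { sleft : word; spiece : piece; sright : word }.

Definition sdom (s : slice) : word := sleft s ++ pdom (spiece s) ++ sright s.
Definition scod (s : slice) : word := sleft s ++ pcod (spiece s) ++ sright s.

(* [diagram a D b]: the stack [D] is a Y-oriented diagram with bottom boundary
   [a] and top boundary [b]. *)
Fixpoint diagram (a : word) (D : seq slice) (b : word) : Prop :=
  match D with
  | [::] => a = b
  | s :: D' => [/\ a = sdom s, y_oriented (spiece s) & diagram (scod s) D' b]
  end.

(* Adding vertical strands on both sides of a stack. *)
Definition whisker (l : word) (D : seq slice) (r : word) : seq slice :=
  [seq Slice (l ++ sleft s) (spiece s) (sright s ++ r) | s <- D].

(* Elementary planar isotopies: exchanging the heights of two pieces lying
   side by side, cancelling a minimum with an adjacent maximum, and turning a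
   crossing by a quarter turn or a vertex by a sixth of a turn (in either
   sense). *)
Inductive isotopy : seq slice -> seq slice -> Prop :=
| iso_exchange (m : word) (g h : piece) :
    isotopy [:: Slice [::] g (m ++ pdom h); Slice (pcod g ++ m) h [::]]
            [:: Slice (pdom g ++ m) h [::]; Slice [::] g (m ++ pcod h)]
| iso_zigzag_left (x : dir) :
    isotopy [:: Slice [:: x] (Cup (opp x)) [::]; Slice [::] (Cap x) [:: x]]
            [::]
| iso_zigzag_right (x : dir) :
    isotopy [:: Slice [::] (Cup x) [:: x]; Slice [:: x] (Cap (opp x)) [::]]
            [::]
| iso_cross_left (x y : dir) (o : level) :
    isotopy [:: Slice [::] (Cross x y o) [::]]
            [:: Slice [:: x; y] (Cup (opp x)) [::];
                Slice [:: x] (Cross y (opp x) (flip o)) [:: x];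
                Slice [::] (Cap x) [:: y; x]]
| iso_cross_right (x y : dir) (o : level) :
    isotopy [:: Slice [::] (Cross x y o) [::]]
            [:: Slice [::] (Cup y) [:: x; y];
                Slice [:: y] (Cross (opp y) x (flip o)) [:: y];
                Slice [:: y; x] (Cap (opp y)) [::]]
| iso_join_left (x y z : dir) :
    isotopy [:: Slice [::] (Join x y z) [::]]
            [:: Slice [:: x] (Fork y (opp x) z) [::];
                Slice [::] (Cap x) [:: z]]
| iso_join_right (x y z : dir) :
    isotopy [:: Slice [::] (Join x y z) [::]]
            [:: Slice [::] (Fork x z (opp y)) [:: y];
                Slice [:: z] (Cap (opp y)) [::]].

Inductive vtype := Splitting | Merging.

(* The edges at the vertex of an R4 or R5 move: [E0] is the edge e_0 (drawn at
   the bottom), [E1] the left and [E2] the right one of the other two edges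
   (drawn at the top), in the uncrossed diagram for R4. *)
Inductive leg := E0 | E1 | E2.

Definition same_leg (e f : leg) : bool :=
  match e, f with E0, E0 | E1, E1 | E2, E2 => true | _, _ => false end.

(* Whether [e] is outgoing at a vertex of type [t] with special edge [p]. *)
Definition outgoing (t : vtype) (p e : leg) : bool :=
  if t is Merging then same_leg e p else ~~ same_leg e p.

Definition leg_dir (t : vtype) (p e : leg) : dir :=
  if e is E0 then (if outgoing t p e then Dn else Up)
  else (if outgoing t p e then Up else Dn).

(* Oriented moves, one representative for each planar isotopy class (up to
   exchanging the two sides):
   - [R1 c o]: an upward strand acquires a kink whose loop is clockwise iff
     [c]; at its crossing the strand going from bottom left to top right is
     [o] the other one (4 moves);
   - [R2 x y]: vertical strands, the left one of direction [x] passing over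
     the right one of direction [y] (4 moves; a half turn of the disk makes
     the over strand the left one);
   - [R3 y z o]: the topmost strand goes from bottom left to top right and is
     directed upwards, the other two start at the bottom middle and at the
     bottom right with directions [y] and [z], the former being [o] the
     latter (8 moves; rotations of the disk by multiples of a sixth of a turn
     put the topmost strand in this position);
   - [R4 t p o]: vertex type [t], special edge [p], and at the crossing the
     left twisted edge is [o] the right one (12 moves);
   - [R5 t p x o]: vertex type [t], special edge [p], and the moving strand,
     which goes from left to right iff [x] is [Up], is [o] the edges of the
     vertex (24 moves). *)
Inductive move :=
| R1 of bool & level
| R2 of dir & dir
| R3 of dir & dir & level
| R4 of vtype & leg & level
| R5 of vtype & leg & dir & level.

Definition mdom (m : move) : word :=
  match m with
  | R1 _ _ => [:: Up]
  | R2 x y => [:: x; y]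
  | R3 y z _ => [:: Up; y; z]
  | R4 t p _ => [:: leg_dir t p E0]
  | R5 t p x _ => [:: x; leg_dir t p E0]
  end.

Definition mcod (m : move) : word :=
  match m with
  | R1 _ _ => [:: Up]
  | R2 x y => [:: x; y]
  | R3 y z _ => [:: z; y; Up]
  | R4 t p _ => [:: leg_dir t p E1; leg_dir t p E2]
  | R5 t p x _ => [:: leg_dir t p E1; leg_dir t p E2; x]
  end.

Definition lhs (m : move) : seq slice :=
  match m with
  | R1 _ _ => [::]
  | R2 _ _ => [::]
  | R3 y z o =>
      [:: Slice [::] (Cross Up y Over) [:: z];
          Slice [:: y] (Cross Up z Over) [::];
          Slice [::] (Cross y z o) [:: Up]]
  | R4 t p _ =>
      [:: Slice [::] (Fork (leg_dir t p E0) (leg_dir t p E1) (leg_dir t p E2))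
            [::]]
  | R5 t p x o =>
      [:: Slice [::] (Cross x (leg_dir t p E0) o) [::];
          Slice [::] (Fork (leg_dir t p E0) (leg_dir t p E1) (leg_dir t p E2))
            [:: x]]
  end.

Definition rhs (m : move) : seq slice :=
  match m with
  | R1 true o =>
      [:: Slice [:: Up] (Cup Up) [::];
          Slice [::] (Cross Up Up o) [:: Dn];
          Slice [:: Up] (Cap Up) [::]]
  | R1 false o =>
      [:: Slice [::] (Cup Dn) [:: Up];
          Slice [:: Dn] (Cross Up Up o) [::];
          Slice [::] (Cap Dn) [:: Up]]
  | R2 x y =>
      [:: Slice [::] (Cross x y Over) [::];
          Slice [::] (Cross y x Under) [::]]
  | R3 y z o =>
      [:: Slice [:: Up] (Cross y z o) [::];
          Slice [::] (Cross Up z Over) [:: y];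
          Slice [:: z] (Cross Up y Over) [::]]
  | R4 t p o =>
      [:: Slice [::] (Fork (leg_dir t p E0) (leg_dir t p E2) (leg_dir t p E1))
            [::];
          Slice [::] (Cross (leg_dir t p E2) (leg_dir t p E1) (flip o)) [::]]
  | R5 t p x o =>
      [:: Slice [:: x]
            (Fork (leg_dir t p E0) (leg_dir t p E1) (leg_dir t p E2)) [::];
          Slice [::] (Cross x (leg_dir t p E1) o) [:: leg_dir t p E2];
          Slice [:: leg_dir t p E1] (Cross x (leg_dir t p E2) o) [::]]
  end.

Lemma move_diagrams (m : move) :
  diagram (mdom m) (lhs m) (mcod m) /\ diagram (mdom m) (rhs m) (mcod m).
Proof.
by case: m => [[] []|[] []|[] [] []|[] [] []|[] [] [] []] /=; do !split.
Qed.

Inductive rule (S : set move) : seq slice -> seq slice -> Prop :=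
| rule_isotopy T T' : isotopy T T' -> rule S T T'
| rule_move m : S m -> rule S (lhs m) (rhs m).

(* One elementary planar isotopy or move of [S], performed inside a
   sub-rectangle of a diagram with boundary [a], [b]. *)
Inductive step (S : set move) (a b : word) : seq slice -> seq slice -> Prop :=
| Step (l r : word) (D1 T T' D2 : seq slice) :
    rule S T T' ->
    diagram a (D1 ++ whisker l T r ++ D2) b ->
    diagram a (D1 ++ whisker l T' r ++ D2) b ->
    step S a b (D1 ++ whisker l T r ++ D2) (D1 ++ whisker l T' r ++ D2).

(* [m] is a finite sequence of planar isotopies and moves of [S] or their
   inverses, inside the disk of [m]. *)
Definition realizable (S : set move) (m : move) : Prop :=
  clos_refl_sym_trans (seq slice) (step S (mdom m) (mcod m)) (lhs m) (rhs m).

Definition generates (S M : set move) : Prop :=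
  forall m, M m -> realizable S m.

Definition classical_moves : set move :=
  [set m | match m with R1 _ _ | R2 _ _ | R3 _ _ _ => True | _ => False end].

Definition minimal_classical_generating_set (C : set move) : Prop :=
  [/\ C `<=` classical_moves, generates C classical_moves &
      forall C' : set move, C' `<` C -> ~ generates C' classical_moves].

Definition generating_set (S : set move) : Prop := generates S setT.

Definition A_moves (t : vtype) : set move := [set m | exists p o, m = R4 t p o].

Definition B_moves (t : vtype) (o : level) : set move :=
  [set m | exists p x, m = R5 t p x o].

(* Main.v *)
Require Import Defs.
From Stdlib Require Import Relations.
From mathcomp Require Import all_boot classical_sets.
Set Implicit Arguments.
Unset Strict Implicit.
Unset Printing Implicit Defensive.

(** The classical moves are realizable by hypothesis, so only the R4 and R5
    moves need an argument, and it suffices to pass between moves of the same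
    vertex type (and, for R5, the same level of the strand).

    R5 ([strand_passes_turn]).  Let a strand [s] cross one leg of a vertex.  By
    an R2 move, push a finger of [s] across a second leg: [s] now crosses the
    second leg twice, and the part of [s] nearest to the vertex crosses the
    first and the second leg once each.  An R5 move carries this part across
    the vertex to the third leg, and the result is [s] crossing the second and
    the third leg instead of the first.  So the R5 move at the third leg gives
    the R5 move at the first one.  The side of [s] on which the vertex lies when
    [s] crosses two legs in the former is the side on which it lies when [s]
    crosses a single leg in the latter, so these two moves have opposite
    directions of [s].  Thus a step changes the position of the special edge
    cyclically (three positions) and reverses the strand (two directions), and
    the six moves of a class form one cycle.

    R4 ([legs_twist_turn]).  After twisting, a leg [l] leaves the vertex on the
    far side of a leg [r] and crosses [r] to return to its end, between [r] and
    the third leg [b] on the boundary of the disk.  Add a kink to [l] by R1,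
    so that the part of [l] which turns around the vertex crosses [l] itself
    and [r].  An R5 move carries this part across the vertex, where it crosses
    [b]: the kink has gone and the diagram is [l] twisted with [b], [l] being
    on the same level as before.  In terms of left and right, the level is now
    reversed while the special edge has moved cyclically, so again the six
    moves of a class form one cycle.

    Both arguments are carried out on stacks of slices.  Everything that the
    eye supplies in the pictures above is an explicit chain of stacks, each
    obtained from the one before by a known equivalence inside a rectangle
    (tactic [at]) or by exchanging heights of distant pieces (tactic [exch]). *)

Local Open Scope classical_set_scope.

Local Notation "x ^*" := (opp x).
Local Notation "l <| g |> r" := (Slice l g r) (at level 60, g at level 59, no associativity).

Lemma oppK x : x^*^* = x. Proof. by case: x. Qed.

Lemma flipK o : flip (flip o) = o. Proof. by case: o. Qed.

(** * Equivalence of diagrams as a congruence *)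

Lemma diagram_cat a c b D E :
  diagram a D c -> diagram c E b -> diagram a (D ++ E) b.
Proof.
by elim: D a => [|s D IH] a /= => [->|[-> ys /IH tD] /tD]; first by [].
Qed.

Lemma diagram_whisker l r a D b :
  diagram a D b -> diagram (l ++ a ++ r) (whisker l D r) (l ++ b ++ r).
Proof.
elim: D a => [|[u g v] D IH] a /= => [->//|[-> yg /IH]].
by rewrite /sdom /scod /= -!catA => ?.
Qed.

Lemma whisker_cat l r D E : whisker l (D ++ E) r = whisker l D r ++ whisker l E r.
Proof. exact: map_cat. Qed.

Lemma whisker_whisker l r l' r' D :
  whisker l (whisker l' D r') r = whisker (l ++ l') D (r' ++ r).
Proof. by rewrite /whisker -map_comp; apply: eq_map => -[u g v]; rewrite /= !catA. Qed.

Lemma whisker0 D : whisker [::] D [::] = D.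
Proof. by elim: D => [|[u g v] D /= ->] //=; rewrite cats0. Qed.

Definition eqv (S : set move) (a b : word) := clos_refl_sym_trans _ (step S a b).

Lemma eqv_refl S a b D : eqv S a b D D. Proof. exact: rst_refl. Qed.

Lemma eqv_sym S a b D E : eqv S a b D E -> eqv S a b E D.
Proof. exact: rst_sym. Qed.

Lemma eqv_trans S a b D E F : eqv S a b D E -> eqv S a b E F -> eqv S a b D F.
Proof. exact: rst_trans. Qed.

Lemma eqv_rule S a b T T' :
  rule S T T' -> diagram a T b -> diagram a T' b -> eqv S a b T T'.
Proof.
move=> rT tT tT'; apply: rst_step.
have := @Step S a b [::] [::] [::] T T' [::] rT.
by rewrite !whisker0 !cats0; apply.
Qed.

Lemma eqv_iso S a b T T' :
  isotopy T T' -> diagram a T b -> diagram a T' b -> eqv S a b T T'.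
Proof. by move=> iT; apply/eqv_rule/rule_isotopy. Qed.

Lemma eqv_ctx S a b c d l r D1 D2 T T' :
    eqv S c d T T' ->
    diagram a D1 (l ++ c ++ r) -> diagram (l ++ d ++ r) D2 b ->
  eqv S a b (D1 ++ whisker l T r ++ D2) (D1 ++ whisker l T' r ++ D2).
Proof.
move=> e t1 t2; elim: e => [_ _ []|D|D E _|D E F _ ? _]; first last.
- exact: eqv_trans.
- exact: eqv_sym.
- exact: eqv_refl.
move=> l' r' E1 U U' E2 rU tU tU'; apply: rst_step.
have ctxE V : D1 ++ whisker l (E1 ++ whisker l' V r' ++ E2) r ++ D2 =
    (D1 ++ whisker l E1 r) ++ whisker (l ++ l') V (r' ++ r) ++ whisker l E2 r ++ D2.
  by rewrite !whisker_cat whisker_whisker -!catA.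
have ctxT V : diagram c V d -> diagram a (D1 ++ whisker l V r ++ D2) b.
  by move=> tV; apply: (diagram_cat t1); apply: diagram_cat t2; apply: diagram_whisker.
by rewrite !ctxE; apply: Step rU _ _; rewrite -ctxE; apply: ctxT.
Qed.

(** [k] slices lie below the rectangle where [T] is replaced, and the strands
    [l] and [r] beside it.  The whole stacks appear as variables, so that they
    can be displayed as plain lists. *)
Lemma eqv_at k l r S a b c d T T' X Y :
    eqv S c d T T' ->
    X = take k X ++ whisker l T r ++ drop (k + size T) X ->
    Y = take k X ++ whisker l T' r ++ drop (k + size T) X ->
    diagram a (take k X) (l ++ c ++ r) ->
    diagram (l ++ d ++ r) (drop (k + size T) X) b ->
  eqv S a b X Y.
Proof. by move=> e eX -> tX tY; rewrite {1}eX; apply: eqv_ctx e _ _. Qed.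

Lemma eqv_cons S a b s D E :
  a = sdom s -> y_oriented (spiece s) ->
  eqv S (scod s) b D E -> eqv S a b (s :: D) (s :: E).
Proof.
move=> -> ys e; have := @eqv_ctx S (sdom s) b _ _ [::] [::] [:: s] [::] _ _ e.
by rewrite /= !whisker0 !cats0; apply.
Qed.

Lemma eqv_sub S S' a b D E : S `<=` S' -> eqv S a b D E -> eqv S' a b D E.
Proof.
move=> sub; elim=> [_ _ [l r D1 T T' D2 rT tT tT']|?|? ? _|? ? ? _ IH1 _].
- apply: rst_step; apply: Step tT tT'.
  by case: rT => [? ? /rule_isotopy|m /sub/rule_move]; apply.
- exact: eqv_refl.
- exact: eqv_sym.
- exact: eqv_trans IH1.
Qed.

(** * Height exchanges by normalization *)

(** The upper slice [t] goes below [s] if its piece lies to the right of the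
    one of [s].  Only this direction is used, as exchanging always the same way
    leads to a normal form on the diagrams met below. *)
Definition hop (s t : slice) : option (seq slice) :=
  let: l <| g |> _ := s in let: l' <| h |> r := t in
  if size (l ++ pcod g) <= size l' then
    let m := drop (size (l ++ pcod g)) l' in
    Some [:: (l ++ pdom g ++ m) <| h |> r; l <| g |> (m ++ pcod h ++ r)]
  else None.

Fixpoint hop_first (D : seq slice) : option (seq slice) :=
  if D is s :: D' then
    if D' is t :: D'' then
      if hop s t is Some E then Some (E ++ D'') else omap (cons s) (hop_first D')
    else None
  else None.

Fixpoint settle n (D : seq slice) : seq slice :=
  if n is n'.+1 then
    if hop_first D is Some E then settle n' E else D
  else D.

(** The strands strictly between the two pieces play the role of [m] in
    [iso_exchange]; they are recovered by comparing lengths. *)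
Lemma hop_eqv S a b s t D E :
  hop s t = Some E -> diagram a [:: s, t & D] b ->
  eqv S a b [:: s, t & D] (E ++ D) /\ diagram a (E ++ D) b.
Proof.
case: s t => [l g r0] [l' h r] /=; case: ifP => // le_l [<-].
move: le_l; set m := drop _ _; rewrite /sdom /scod /= => le_l [-> yg [e yh tD]].
have l'E : l' = l ++ pcod g ++ m.
  move/(congr1 (take (size (l ++ pcod g)))): e.
  rewrite catA take_size_cat // takel_cat // => e.
  by rewrite catA {1}e cat_take_drop.
clearbody m; subst l'.
move/(congr1 (drop (size (l ++ pcod g)))): e.
rewrite -catA (catA l) drop_size_cat // -!catA (catA l) drop_size_cat // => r0E.
subst r0; split; last by rewrite /sdom /scod /= -!catA in tD *.
have := @eqv_ctx S (l ++ pdom g ++ m ++ pdom h ++ r) b (pdom g ++ m ++ pdom h)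
  (pcod g ++ m ++ pcod h) l r [::] D _ _ (eqv_iso S (iso_exchange m g h) _ _).
rewrite /= !cats0 -!catA; apply; rewrite /sdom /scod /= ?cats0 -?catA //.
by rewrite -?catA in tD.
Qed.

Lemma hop_first_eqv S a b D E :
  hop_first D = Some E -> diagram a D b -> eqv S a b D E /\ diagram a E b.
Proof.
elim: D a E => // s [//|t D] IH a E.
rewrite (_ : hop_first _ = if hop s t is Some F then Some (F ++ D)
  else omap (cons s) (hop_first (t :: D))) //.
case hopE: (hop s t) => [F|].
  by move=> [<-]; apply: hop_eqv.
case hopD: (hop_first _) => [F|] //= [<-] [aE ys tD].
have [e tF] := IH _ _ hopD tD.
by split; [apply: eqv_cons|].
Qed.

Lemma settle_eqv S n a b D :
  diagram a D b -> eqv S a b D (settle n D) /\ diagram a (settle n D) b.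
Proof.
elim: n D => [|n IH] D tD /=; first by split => //; apply: eqv_refl.
case hopE: (hop_first D) => [E|]; last by split=> //; apply: eqv_refl.
have [e tE] := hop_first_eqv S hopE tD; have [e' ?] := IH _ tE.
by split=> //; apply: eqv_trans e e'.
Qed.

(** The bound only has to exceed the number of exchanges; the stacks below have
    at most a dozen slices.  Soundness does not depend on reaching a normal
    form. *)
Lemma eqv_exchange S a b D E :
    settle 99 D = settle 99 E -> diagram a D b -> diagram a E b ->
  eqv S a b D E.
Proof.
move=> DE /(settle_eqv S 99)[eD _] /(settle_eqv S 99)[eE _].
by apply: eqv_trans eD _; rewrite DE; apply: eqv_sym.
Qed.

(* Directions occur as variables in the stacks.  Their doubled opposites do
   not compute, so typing is checked for each of their values. *)
Ltac typed := cbn; repeat match goal with x : dir |- _ => destruct x end;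
  by [].
Ltac exch := apply: eqv_exchange; [by rewrite /= ?oppK | typed | typed].
Tactic Notation "at" constr(k) constr(l) constr(r) open_constr(e) :=
  apply: (@eqv_at k l r _ _ _ _ _ _ _ _ _ e);
    [by rewrite /= ?oppK ?flipK | by rewrite /= ?oppK ?flipK | typed | typed].
Ltac to Y := refine (@eqv_trans _ _ _ _ Y _ _ _).

(** * Sliding strands over extrema and around vertices *)

Lemma zigzag_left S x :
  eqv S [:: x] [:: x] [:: [:: x] <| Cup x^* |> [::]; [::] <| Cap x |> [:: x]] [::].
Proof. by apply: (eqv_iso _ (iso_zigzag_left x)); typed. Qed.

Lemma zigzag_right S x :
  eqv S [:: x] [:: x] [:: [::] <| Cup x |> [:: x]; [:: x] <| Cap x^* |> [::]] [::].
Proof. by apply: (eqv_iso _ (iso_zigzag_right x)); typed. Qed.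

Lemma cross_left S x y o :
  eqv S [:: x; y] [:: y; x] [:: [::] <| Cross x y o |> [::]]
    [:: [:: x; y] <| Cup x^* |> [::];
        [:: x] <| Cross y x^* (flip o) |> [:: x];
        [::] <| Cap x |> [:: y; x]].
Proof. by apply: (eqv_iso _ (iso_cross_left x y o)); typed. Qed.

Lemma cross_right S x y o :
  eqv S [:: x; y] [:: y; x] [:: [::] <| Cross x y o |> [::]]
    [:: [::] <| Cup y |> [:: x; y];
        [:: y] <| Cross y^* x (flip o) |> [:: y];
        [:: y; x] <| Cap y^* |> [::]].
Proof. by apply: (eqv_iso _ (iso_cross_right x y o)); typed. Qed.

(** The two sides are quarter turns of the same crossing; turning one of them
    creates a minimum which cancels with the cap. *)
Lemma cap_slide S a x o :
  eqv S [:: a; x; a^*] [:: x]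
    [:: [:: a] <| Cross x a^* o |> [::]; [::] <| Cap a |> [:: x]]
    [:: [::] <| Cross a x (flip o) |> [:: a^*]; [:: x] <| Cap a |> [::]].
Proof.
apply: eqv_sym.
to [:: [:: a; x] <| Cup a^* |> [:: a^*];
       [:: a] <| Cross x a^* o |> [:: a; a^*];
       [::] <| Cap a |> [:: x; a; a^*];
       [:: x] <| Cap a |> [::]].
  at 0 (Nil dir) [:: a^*] (cross_left S a x (flip o)).
to [:: [:: a; x] <| Cup a^* |> [:: a^*];
       [:: a; x; a^*] <| Cap a |> [::];
       [:: a] <| Cross x a^* o |> [::];
       [::] <| Cap a |> [:: x]].
  exch.
at 0 [:: a; x] (Nil dir) (zigzag_right S a^*).
Qed.

Lemma cup_slide S b x o :
  eqv S [:: x] [:: b; x; b^*]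
    [:: [:: x] <| Cup b |> [::]; [::] <| Cross x b o |> [:: b^*]]
    [:: [::] <| Cup b |> [:: x]; [:: b] <| Cross b^* x (flip o) |> [::]].
Proof.
to [:: [:: x] <| Cup b |> [::];
       [::] <| Cup b |> [:: x; b; b^*];
       [:: b] <| Cross b^* x (flip o) |> [:: b; b^*];
       [:: b; x] <| Cap b^* |> [:: b^*]].
  at 1 (Nil dir) [:: b^*] (cross_right S x b o).
to [:: [::] <| Cup b |> [:: x];
       [:: b] <| Cross b^* x (flip o) |> [::];
       [:: b; x; b^*] <| Cup b |> [::];
       [:: b; x] <| Cap b^* |> [:: b^*]].
  exch.
at 2 [:: b; x] (Nil dir) (zigzag_left S b^*).
Qed.

(** A crossing slides along two nested caps, arriving after a half turn, which
    restores its level. *)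
Lemma cap_cap_slide S x y o :
  eqv S [:: x; y; x^*; y^*] [::]
    [:: [::] <| Cross x y o |> [:: x^*; y^*]; [:: y] <| Cap x |> [:: y^*]; [::] <| Cap y |> [::]]
    [:: [:: x; y] <| Cross x^* y^* o |> [::]; [:: x] <| Cap y |> [:: x^*]; [::] <| Cap x |> [::]].
Proof.
to [:: [:: x] <| Cross y x^* (flip o) |> [:: y^*]; [::] <| Cap x |> [:: y; y^*];
       [::] <| Cap y |> [::]].
  apply: eqv_sym; at 0 (Nil dir) [:: y^*] (cap_slide S x y (flip o)).
to [:: [:: x] <| Cross y x^* (flip o) |> [:: y^*]; [:: x; x^*] <| Cap y |> [::];
       [::] <| Cap x |> [::]].
  exch.
apply: eqv_sym; at 0 [:: x] (Nil dir) (cap_slide S y x^* o).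
Qed.

Lemma cup_cup_slide S x b o :
  eqv S [::] [:: b; x; b^*; x^*]
    [:: [::] <| Cup x |> [::]; [:: x] <| Cup b |> [:: x^*]; [::] <| Cross x b o |> [:: b^*; x^*]]
    [:: [::] <| Cup b |> [::]; [:: b] <| Cup x |> [:: b^*]; [:: b; x] <| Cross x^* b^* o |> [::]].
Proof.
to [:: [::] <| Cup x |> [::]; [::] <| Cup b |> [:: x; x^*];
       [:: b] <| Cross b^* x (flip o) |> [:: x^*]].
  at 1 (Nil dir) [:: x^*] (cup_slide S b x o).
to [:: [::] <| Cup b |> [::]; [:: b; b^*] <| Cup x |> [::];
       [:: b] <| Cross b^* x (flip o) |> [:: x^*]].
  exch.
at 1 [:: b] (Nil dir) (cup_slide S x b^* (flip o)).
Qed.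

Lemma join_left S x y z : y_oriented (Join x y z) ->
  eqv S [:: x; y] [:: z] [:: [::] <| Join x y z |> [::]]
    [:: [:: x] <| Fork y x^* z |> [::]; [::] <| Cap x |> [:: z]].
Proof. by move=> xyz; apply: (eqv_iso _ (iso_join_left x y z)); typed. Qed.

Lemma join_right S x y z : y_oriented (Join x y z) ->
  eqv S [:: x; y] [:: z] [:: [::] <| Join x y z |> [::]]
    [:: [::] <| Fork x z y^* |> [:: y]; [:: z] <| Cap y^* |> [::]].
Proof. by move=> xyz; apply: (eqv_iso _ (iso_join_right x y z)); typed. Qed.

Lemma fork_left S b l r : y_oriented (Fork b l r) ->
  eqv S [:: b] [:: l; r] [:: [::] <| Fork b l r |> [::]]
    [:: [::] <| Cup l |> [:: b]; [:: l] <| Join l^* b r |> [::]].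
Proof.
move=> blr; apply: eqv_sym.
to [:: [::] <| Cup l |> [:: b]; [:: l; l^*] <| Fork b l r |> [::]; [:: l] <| Cap l^* |> [:: r]].
  have v : y_oriented (Join l^* b r) by typed.
  at 1 [:: l] (Nil dir) (join_left S v).
to [:: [::] <| Fork b l r |> [::]; [::] <| Cup l |> [:: l; r]; [:: l] <| Cap l^* |> [:: r]].
  exch.
at 1 (Nil dir) [:: r] (zigzag_right S l).
Qed.

Lemma fork_right S b l r : y_oriented (Fork b l r) ->
  eqv S [:: b] [:: l; r] [:: [::] <| Fork b l r |> [::]]
    [:: [:: b] <| Cup r^* |> [::]; [::] <| Join b r^* l |> [:: r]].
Proof.
move=> blr; apply: eqv_sym.
to [:: [:: b] <| Cup r^* |> [::]; [::] <| Fork b l r |> [:: r^*; r]; [:: l] <| Cap r |> [:: r]].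
  have v : y_oriented (Join b r^* l) by typed.
  at 1 (Nil dir) [:: r] (join_right S v).
to [:: [::] <| Fork b l r |> [::]; [:: l; r] <| Cup r^* |> [::]; [:: l] <| Cap r |> [:: r]].
  exch.
at 1 [:: l] (Nil dir) (zigzag_left S r).
Qed.

(** If the left strand is the lower one, a half turn of the disk is needed.  The
    two strands are bent into an S-shape by nested caps and cups, and both
    crossings are slid along the caps.  This turns each of them and reverses
    their order, giving an R2 move on the middle part of the S. *)
Lemma r2_both_levels S x y o : (forall u v, realizable S (R2 u v)) ->
  eqv S [:: x; y] [:: x; y]
    [:: [::] <| Cross x y o |> [::]; [::] <| Cross y x (flip o) |> [::]] [::].
Proof.
move=> r2; apply: eqv_sym; case: o; first exact: r2.
pose cups := [:: [:: x; y] <| Cup y^* |> [::]; [:: x; y; y^*] <| Cup x^* |> [:: y]].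
pose bend := cups ++ [:: [:: x] <| Cap y |> [:: x^*; x; y]; [::] <| Cap x |> [:: x; y]].
have bendE : eqv S [:: x; y] [:: x; y] bend [::].
  to [:: [:: x; y] <| Cup y^* |> [::]; [:: x] <| Cap y |> [:: y];
         [:: x] <| Cup x^* |> [:: y]; [::] <| Cap x |> [:: x; y]].
    exch.
  to [:: [:: x] <| Cup x^* |> [:: y]; [::] <| Cap x |> [:: x; y]].
    at 0 [:: x] (Nil dir) (zigzag_left S y).
  at 0 (Nil dir) [:: y] (zigzag_left S x).
apply: eqv_sym.
to ([:: [::] <| Cross x y Under |> [::]; [::] <| Cross y x Over |> [::]] ++ bend).
  at 2 (Nil dir) (Nil dir) (eqv_sym bendE).
to (cups ++ [:: [::] <| Cross x y Under |> [:: y^*; x^*; x; y];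
                [::] <| Cross y x Over |> [:: y^*; x^*; x; y];
                [:: x] <| Cap y |> [:: x^*; x; y];
                [::] <| Cap x |> [:: x; y]]).
  exch.
to (cups ++ [:: [::] <| Cross x y Under |> [:: y^*; x^*; x; y];
                [:: y; x] <| Cross y^* x^* Over |> [:: x; y];
                [:: y] <| Cap x |> [:: y^*; x; y];
                [::] <| Cap y |> [:: x; y]]).
  at 3 (Nil dir) [:: x; y] (cap_cap_slide S y x Over).
to (cups ++ [:: [:: x; y] <| Cross y^* x^* Over |> [:: x; y];
                [::] <| Cross x y Under |> [:: x^*; y^*; x; y];
                [:: y] <| Cap x |> [:: y^*; x; y];
                [::] <| Cap y |> [:: x; y]]).
  exch.
to (cups ++ [:: [:: x; y] <| Cross y^* x^* Over |> [:: x; y];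
                [:: x; y] <| Cross x^* y^* Under |> [:: x; y];
                [:: x] <| Cap y |> [:: x^*; x; y];
                [::] <| Cap x |> [:: x; y]]).
  at 3 (Nil dir) [:: x; y] (cap_cap_slide S x y Under).
apply: eqv_trans bendE.
at 2 [:: x; y] [:: x; y] (eqv_sym (r2 y^* x^* : eqv S _ _ _ _)).
Qed.

(** A quarter turn of the crossing exhibits the loop of an R1 move on the
    upward strand of the cap. *)
Lemma kinked_cap S l o : (forall c u, realizable S (R1 c u)) ->
  eqv S [:: l^*; l] [::]
    [:: [::] <| Cross l^* l o |> [::]; [::] <| Cap l |> [::]] [:: [::] <| Cap l^* |> [::]].
Proof.
move=> r1; case: l => /=.
  to [:: [:: Dn; Up] <| Cup Up |> [::]; [:: Dn] <| Cross Up Up (flip o) |> [:: Dn];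
         [::] <| Cap Dn |> [:: Up; Dn]; [::] <| Cap Up |> [::]].
    at 0 (Nil dir) (Nil dir) (cross_left S Dn Up o).
  to [:: [:: Dn; Up] <| Cup Up |> [::]; [:: Dn] <| Cross Up Up (flip o) |> [:: Dn];
         [:: Dn; Up] <| Cap Up |> [::]; [::] <| Cap Dn |> [::]].
    exch.
  at 0 [:: Dn] (Nil dir) (eqv_sym (r1 true (flip o) : eqv S _ _ _ _)).
to [:: [::] <| Cup Dn |> [:: Up; Dn]; [:: Dn] <| Cross Up Up (flip o) |> [:: Dn];
       [:: Dn; Up] <| Cap Up |> [::]; [::] <| Cap Dn |> [::]].
  at 0 (Nil dir) (Nil dir) (cross_right S Up Dn o).
to [:: [::] <| Cup Dn |> [:: Up; Dn]; [:: Dn] <| Cross Up Up (flip o) |> [:: Dn];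
       [::] <| Cap Dn |> [:: Up; Dn]; [::] <| Cap Up |> [::]].
  exch.
at 0 (Nil dir) [:: Dn] (eqv_sym (r1 false (flip o) : eqv S _ _ _ _)).
Qed.

(** * Changing the special edge in an R5 move *)

Definition strand_before (b l r x : dir) (o : level) :=
  [:: [::] <| Cross x b o |> [::]; [::] <| Fork b l r |> [:: x]].

Definition strand_after (b l r x : dir) (o : level) :=
  [:: [:: x] <| Fork b l r |> [::]; [::] <| Cross x l o |> [:: r]; [:: l] <| Cross x r o |> [::]].

(** R5 moves are stated for arbitrary directions of the legs, rather than by the
    position of the special edge, so that turning the vertex is a cyclic shift
    of the legs. *)
Definition strand_passes S b l r x o :=
  eqv S [:: x; b] [:: l; r; x] (strand_before b l r x o) (strand_after b l r x o).

(** The rotated R5 move, with its disk bent so that [l] and [b] both come from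
    below.  Read from right to left: the R5 move carries the strand from [b] to
    [l] and [r], and its second crossing with [r] cancels with the given one. *)
Lemma strand_passes_join S b l r x o :
    (forall u v, realizable S (R2 u v)) -> y_oriented (Fork b l r) ->
    strand_passes S b l r x o ->
  eqv S [:: l^*; x; b] [:: x; r]
    [:: [::] <| Cross l^* x (flip o) |> [:: b]; [:: x] <| Join l^* b r |> [::]]
    [:: [:: l^*] <| Cross x b o |> [::]; [::] <| Join l^* b r |> [:: x];
        [::] <| Cross r x (flip o) |> [::]].
Proof.
move=> r2 blr r5; apply: eqv_sym.
have jl : y_oriented (Join l^* b r) by typed.
to [:: [:: l^*] <| Cross x b o |> [::]; [:: l^*] <| Fork b l r |> [:: x];
       [::] <| Cap l^* |> [:: r; x]; [::] <| Cross r x (flip o) |> [::]].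
  at 1 (Nil dir) [:: x] (join_left S jl).
to [:: [:: l^*; x] <| Fork b l r |> [::]; [:: l^*] <| Cross x l o |> [:: r];
       [:: l^*; l] <| Cross x r o |> [::];
       [::] <| Cap l^* |> [:: r; x]; [::] <| Cross r x (flip o) |> [::]].
  at 0 [:: l^*] (Nil dir) r5.
to [:: [:: l^*; x] <| Fork b l r |> [::]; [:: l^*] <| Cross x l o |> [:: r];
       [::] <| Cap l^* |> [:: x; r]; [::] <| Cross x r o |> [::];
       [::] <| Cross r x (flip o) |> [::]].
  exch.
to [:: [:: l^*; x] <| Fork b l r |> [::]; [:: l^*] <| Cross x l o |> [:: r];
       [::] <| Cap l^* |> [:: x; r]].
  at 3 (Nil dir) (Nil dir) (r2_both_levels x r o r2).
to [:: [:: l^*; x] <| Fork b l r |> [::]; [::] <| Cross l^* x (flip o) |> [:: l; r];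
       [:: x] <| Cap l^* |> [:: r]].
  at 1 (Nil dir) [:: r] (cap_slide S l^* x o).
to [:: [::] <| Cross l^* x (flip o) |> [:: b]; [:: x; l^*] <| Fork b l r |> [::];
       [:: x] <| Cap l^* |> [:: r]].
  exch.
at 1 [:: x] (Nil dir) (eqv_sym (join_left S jl)).
Qed.

(** [strand_passes_join] with the strand [x] bent at both ends and the leg [b]
    bent up: [x] runs through the disk in the opposite direction. *)
Lemma strand_passes_turn S b l r x o :
    (forall u v, realizable S (R2 u v)) -> y_oriented (Fork b l r) ->
  strand_passes S b l r x o -> strand_passes S l^* r b^* x^* o.
Proof.
move=> r2 blr r5; rewrite /strand_passes /strand_before /strand_after.
have f : y_oriented (Fork l^* r b^*) by typed.
to [:: [:: x^*; l^*] <| Cup x |> [::]; [:: x^*] <| Cross l^* x (flip o) |> [:: x^*];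
       [::] <| Cap x^* |> [:: l^*; x^*]; [::] <| Fork l^* r b^* |> [:: x^*]].
  at 0 (Nil dir) (Nil dir) (cross_left S x^* l^* o).
to [:: [:: x^*; l^*] <| Cup x |> [::]; [:: x^*] <| Cross l^* x (flip o) |> [:: x^*];
       [::] <| Cap x^* |> [:: l^*; x^*]; [:: l^*] <| Cup b |> [:: x^*];
       [::] <| Join l^* b r |> [:: b^*; x^*]].
  at 3 (Nil dir) [:: x^*] (fork_right S f).
to [:: [:: x^*; l^*] <| Cup x |> [::]; [:: x^*; l^*; x] <| Cup b |> [:: x^*];
       [:: x^*] <| Cross l^* x (flip o) |> [:: b; b^*; x^*];
       [:: x^*; x] <| Join l^* b r |> [:: b^*; x^*];
       [::] <| Cap x^* |> [:: r; b^*; x^*]].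
  exch.
to [:: [:: x^*; l^*] <| Cup x |> [::]; [:: x^*; l^*; x] <| Cup b |> [:: x^*];
       [:: x^*; l^*] <| Cross x b o |> [:: b^*; x^*];
       [:: x^*] <| Join l^* b r |> [:: x; b^*; x^*];
       [:: x^*] <| Cross r x (flip o) |> [:: b^*; x^*];
       [::] <| Cap x^* |> [:: r; b^*; x^*]].
  at 2 [:: x^*] [:: b^*; x^*] (strand_passes_join r2 blr r5).
to [:: [:: x^*; l^*] <| Cup b |> [::]; [:: x^*; l^*; b] <| Cup x |> [:: b^*];
       [:: x^*; l^*; b; x] <| Cross x^* b^* o |> [::];
       [:: x^*] <| Join l^* b r |> [:: x; b^*; x^*];
       [:: x^*] <| Cross r x (flip o) |> [:: b^*; x^*];
       [::] <| Cap x^* |> [:: r; b^*; x^*]].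
  at 0 [:: x^*; l^*] (Nil dir) (cup_cup_slide S x b o).
to [:: [:: x^*; l^*] <| Cup b |> [::]; [:: x^*] <| Join l^* b r |> [:: b^*];
       [:: x^*; r] <| Cup x |> [:: b^*]; [:: x^*] <| Cross r x (flip o) |> [:: x^*; b^*];
       [::] <| Cap x^* |> [:: r; x^*; b^*]; [:: r] <| Cross x^* b^* o |> [::]].
  exch.
to [:: [:: x^*; l^*] <| Cup b |> [::]; [:: x^*] <| Join l^* b r |> [:: b^*];
       [::] <| Cross x^* r o |> [:: b^*]; [:: r] <| Cross x^* b^* o |> [::]].
  at 2 (Nil dir) [:: b^*] (eqv_sym (cross_left S x^* r o)).
at 0 [:: x^*] (Nil dir) (eqv_sym (fork_right S f)).
Qed.

(** * Changing the special edge in an R4 move *)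

(** R4 moves for arbitrary directions of the legs, as in [strand_passes]. *)
Definition legs_twist S b l r o :=
  eqv S [:: b] [:: l; r] [:: [::] <| Fork b l r |> [::]]
    [:: [::] <| Fork b r l |> [::]; [::] <| Cross r l (flip o) |> [::]].

(** Both sides are the vertex with its three legs pointing down, the legs being
    bent around it in different ways. *)
Lemma fork_caps S b r l : y_oriented (Fork b r l) ->
  eqv S [:: b; l^*; r^*] [::]
    [:: [::] <| Fork b r l |> [:: l^*; r^*]; [:: r] <| Cap l |> [:: r^*]; [::] <| Cap r |> [::]]
    [:: [:: b] <| Join l^* r^* b^* |> [::]; [::] <| Cap b |> [::]].
Proof.
move=> brl.
have j1 : y_oriented (Join b l^* r) by typed.
have j2 : y_oriented (Join l^* r^* b^*) by typed.
to [:: [::] <| Join b l^* r |> [:: r^*]; [::] <| Cap r |> [::]].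
  at 0 (Nil dir) [:: r^*] (eqv_sym (join_right S j1)).
to [:: [:: b] <| Fork l^* b^* r |> [:: r^*]; [::] <| Cap b |> [:: r; r^*]; [::] <| Cap r |> [::]].
  at 0 (Nil dir) [:: r^*] (join_left S j1).
to [:: [:: b] <| Fork l^* b^* r |> [:: r^*]; [:: b; b^*] <| Cap r |> [::]; [::] <| Cap b |> [::]].
  exch.
at 0 [:: b] (Nil dir) (eqv_sym (join_right S j2)).
Qed.

(** The leg [l] is twisted with [r] by the R4 move, receives a kink, and its
    outer part is carried by the R5 move across the vertex, which by then is
    [Fork b r l].  This part is the continuation of [l] after a maximum, whence
    the direction [l^*] of the moving strand. *)
Lemma legs_twist_join S b l r o :
    (forall c u, realizable S (R1 c u)) ->
    y_oriented (Fork b l r) -> strand_passes S b r l l^* o -> legs_twist S b l r o ->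
  eqv S [:: b; r^*] [:: l] [:: [::] <| Join b r^* l |> [::]]
    [:: [:: b] <| Fork r^* l b^* |> [::]; [:: b] <| Cross l b^* o |> [::]; [::] <| Cap b |> [:: l]].
Proof.
move=> r1 blr r5 r4.
have j : y_oriented (Join b r^* l) by typed.
have f1 : y_oriented (Fork b r l) by typed.
have f2 : y_oriented (Fork r^* l b^*) by typed.
to [:: [::] <| Fork b l r |> [:: r^*]; [:: l] <| Cap r |> [::]].
  at 0 (Nil dir) (Nil dir) (join_right S j).
to [:: [::] <| Fork b r l |> [:: r^*]; [::] <| Cross r l (flip o) |> [:: r^*];
       [:: l] <| Cap r |> [::]].
  at 0 (Nil dir) [:: r^*] r4.
to [:: [::] <| Fork b r l |> [:: r^*]; [::] <| Cup l |> [:: r; l; r^*];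
       [:: l] <| Cross l^* r o |> [:: l; r^*]; [:: l; r] <| Cap l^* |> [:: r^*];
       [:: l] <| Cap r |> [::]].
  at 1 (Nil dir) [:: r^*] (cross_right S r l (flip o)).
to [:: [::] <| Fork b r l |> [:: r^*]; [::] <| Cup l |> [:: r; l; r^*];
       [:: l] <| Cross l^* r o |> [:: l; r^*]; [:: l; r] <| Cross l^* l o |> [:: r^*];
       [:: l; r] <| Cap l |> [:: r^*]; [:: l] <| Cap r |> [::]].
  at 3 [:: l; r] [:: r^*] (eqv_sym (kinked_cap l o r1)).
to [:: [::] <| Cup l |> [:: b; r^*]; [:: l; l^*] <| Fork b r l |> [:: r^*];
       [:: l] <| Cross l^* r o |> [:: l; r^*]; [:: l; r] <| Cross l^* l o |> [:: r^*];
       [:: l; r] <| Cap l |> [:: r^*]; [:: l] <| Cap r |> [::]].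
  exch.
to [:: [::] <| Cup l |> [:: b; r^*]; [:: l] <| Cross l^* b o |> [:: r^*];
       [:: l] <| Fork b r l |> [:: l^*; r^*];
       [:: l; r] <| Cap l |> [:: r^*]; [:: l] <| Cap r |> [::]].
  at 1 [:: l] [:: r^*] (eqv_sym r5).
to [:: [:: b] <| Cup l |> [:: r^*]; [::] <| Cross b l (flip o) |> [:: l^*; r^*];
       [:: l] <| Fork b r l |> [:: l^*; r^*];
       [:: l; r] <| Cap l |> [:: r^*]; [:: l] <| Cap r |> [::]].
  apply: eqv_sym; at 0 (Nil dir) [:: r^*] (cup_slide S l b (flip o)).
to [:: [:: b] <| Cup l |> [:: r^*]; [::] <| Cross b l (flip o) |> [:: l^*; r^*];
       [:: l; b] <| Join l^* r^* b^* |> [::]; [:: l] <| Cap b |> [::]].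
  at 2 [:: l] (Nil dir) (fork_caps S f1).
to [:: [:: b] <| Cup l |> [:: r^*]; [:: b; l] <| Join l^* r^* b^* |> [::];
       [::] <| Cross b l (flip o) |> [:: b^*]; [:: l] <| Cap b |> [::]].
  exch.
to [:: [:: b] <| Fork r^* l b^* |> [::];
       [::] <| Cross b l (flip o) |> [:: b^*]; [:: l] <| Cap b |> [::]].
  at 0 [:: b] (Nil dir) (eqv_sym (fork_left S f2)).
at 1 (Nil dir) (Nil dir) (eqv_sym (cap_slide S b l o)).
Qed.

(** [legs_twist_join] with the leg [b] bent up on the left. *)
Lemma legs_twist_turn S b l r o :
    (forall c u, realizable S (R1 c u)) ->
    y_oriented (Fork b l r) -> strand_passes S b r l l^* o -> legs_twist S b l r o ->
  legs_twist S r^* b^* l (flip o).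
Proof.
move=> r1 blr r5 r4; rewrite /legs_twist flipK.
have f : y_oriented (Fork r^* b^* l) by typed.
to [:: [::] <| Cup b^* |> [:: r^*]; [:: b^*] <| Join b r^* l |> [::]].
  at 0 (Nil dir) (Nil dir) (fork_left S f).
to [:: [::] <| Cup b^* |> [:: r^*]; [:: b^*; b] <| Fork r^* l b^* |> [::];
       [:: b^*; b] <| Cross l b^* o |> [::]; [:: b^*] <| Cap b |> [:: l]].
  at 1 [:: b^*] (Nil dir) (legs_twist_join r1 blr r5 r4).
to [:: [::] <| Fork r^* l b^* |> [::]; [::] <| Cross l b^* o |> [::];
       [::] <| Cup b^* |> [:: b^*; l]; [:: b^*] <| Cap b |> [:: l]].
  exch.
at 2 (Nil dir) [:: l] (zigzag_right S b^*).
Qed.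

(** * The six moves of each class form a cycle *)

Lemma realizable_move (S : set move) m : S m -> realizable S m.
Proof.
by move=> Sm; have [? ?] := move_diagrams m; apply: eqv_rule => //; apply: rule_move.
Qed.

Definition prev_leg p := match p with E0 => E2 | E1 => E0 | E2 => E1 end.

Definition next_leg p := match p with E0 => E1 | E1 => E2 | E2 => E0 end.

(** The position of the special edge after the two upper legs have been
    exchanged. *)
Definition mirror_leg p := match p with E0 => E0 | E1 => E2 | E2 => E1 end.

(** The effect of [legs_twist_turn] and [strand_passes_turn] on moves.  It has
    order six on R4 and R5 moves, since it combines a cyclic shift of three
    positions with an involution. *)
Definition turn m :=
  match m with
  | R4 t p o => R4 t (next_leg p) (flip o)
  | R5 t p x o => R5 t (prev_leg p) x^* o
  | _ => m
  end.

Lemma A_moves_turn t k m : A_moves t m -> A_moves t (iter k turn m).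
Proof.
move=> Am; elim: k => [//|k [q [u]] /= ->].
by exists (next_leg q), (flip u).
Qed.

Lemma B_moves_turn t o k m : B_moves t o m -> B_moves t o (iter k turn m).
Proof.
move=> Bm; elim: k => [//|k [q [y]] /= ->].
by exists (prev_leg q), y^*.
Qed.

Ltac six_turns := first [by exists 0 | by exists 1 | by exists 2
  | by exists 3 | by exists 4 | by exists 5].

Lemma A_moves_cycle t m n :
  A_moves t m -> A_moves t n -> exists k, n = iter k turn m.
Proof.
by case=> p [o ->] [q [u ->]]; case: p q o u => [] [] [] []; six_turns.
Qed.

Lemma B_moves_cycle t o m n :
  B_moves t o m -> B_moves t o n -> exists k, n = iter k turn m.
Proof.
by case=> p [x ->] [q [y ->]]; case: p q x y => [] [] [] []; six_turns.
Qed.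

Lemma realizable_B S t o m : (forall u v, realizable S (R2 u v)) ->
  B_moves t o m -> realizable S m -> forall n, B_moves t o n -> realizable S n.
Proof.
move=> r2 Bm rm n Bn; have [k ->] := B_moves_cycle Bm Bn.
elim: k {n Bn} => //= k; have [p [x ->]] := B_moves_turn k Bm.
by case: t p {Bm} => [] [] /(strand_passes_turn r2); apply.
Qed.

Lemma realizable_A S t m : (forall c u, realizable S (R1 c u)) ->
    (forall o n, B_moves t o n -> realizable S n) ->
  A_moves t m -> realizable S m -> forall n, A_moves t n -> realizable S n.
Proof.
move=> r1 r5 Am rm n An; have [k ->] := A_moves_cycle Am An.
elim: k {n An} => //= k; have [p [o ->]] := A_moves_turn k Am.
have {}r5 q x : realizable S (R5 t q x o) by apply: r5; exists q, x.
(* The R5 move takes place after the twist, at the mirrored vertex. *)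
have := r5 (mirror_leg p) (leg_dir t p E1)^*.
by case: t p {Am r5} => [] [] r5 r4; apply: (legs_twist_turn r1 _ r5 r4).
Qed.

Theorem lemma1 (a_s a_m b_so b_mo b_su b_mu : move) (C : set move)
    (ha_s : A_moves Splitting a_s) (ha_m : A_moves Merging a_m)
    (hb_so : B_moves Splitting Over b_so) (hb_mo : B_moves Merging Over b_mo)
    (hb_su : B_moves Splitting Under b_su) (hb_mu : B_moves Merging Under b_mu)
    (hC : minimal_classical_generating_set C) :
  generating_set (C `|` [set a_s; a_m; b_so; b_mo; b_su; b_mu]).
Proof.
set S := C `|` _.
have classical m : classical_moves m -> realizable S m.
  by case: hC => _ gC _ /gC; apply: eqv_sub => ?; left.
have chosen m : [set a_s; a_m; b_so; b_mo; b_su; b_mu] m -> realizable S m.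
  by move=> ?; apply: realizable_move; right.
have r1 c u : realizable S (R1 c u) by apply: classical.
have r2 u v : realizable S (R2 u v) by apply: classical.
have rB t o m : B_moves t o m -> realizable S m.
  move: m; case: t o => [] [].
  - by apply: (realizable_B r2 hb_so); apply: chosen; rewrite /=; tauto.
  - by apply: (realizable_B r2 hb_su); apply: chosen; rewrite /=; tauto.
  - by apply: (realizable_B r2 hb_mo); apply: chosen; rewrite /=; tauto.
  - by apply: (realizable_B r2 hb_mu); apply: chosen; rewrite /=; tauto.
have rA t m : A_moves t m -> realizable S m.
  move: m; case: t.
  - by apply: (realizable_A r1 _ ha_s) => [o|]; [apply: rB | apply: chosen; rewrite /=; tauto].
  - by apply: (realizable_A r1 _ ha_m) => [o|]; [apply: rB | apply: chosen; rewrite /=; tauto].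
case=> [c u|u v|y z o|t p o|t p x o] _; try by apply: classical.
- by apply: (rA t); exists p, o.
- by apply: (rB t o); exists p, x.
Qed.
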